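(* Let $(\gamma_j)_{j\ge1}$ be a non-increasing sequence of non-negative real numbers, and let $\gamma$ be the corresponding product weights $\gamma_{\mathfrak{u}}=\prod_{j\in\mathfrak{u}}\gamma_j$ for non-empty finite $\mathfrak{u}\subset\mathbb{N}=\{1,2,\dots\}$. (i) If for every $c>0$ and every $\eta>0$ the inequality $$ \gamma_j \geq \frac{c}{(\log j)^{\eta}} $$ holds for infinitely many $j$, then the weighted star-discrepancy is not strongly tractable. (ii) If there exist $c>0$ and $\eta>0$ such that $$ \gamma_j \geq \frac{c}{(\log j)^{1/4-\eta}} $$ holds for infinitely many $j$, then, if the weighted star-discrepancy is strongly tractable, its $\varepsilon$-exponent of strong tractability is greater than $2$.
   Context: $\log$ is the natural logarithm. Points in a point set $x_1,\dots,x_N$ are counted with multiplicity. For $x_1,\dots,x_N\in[0,1]^d$ and $z=(z_1,\dots,z_d)\in[0,1]^d$, the discrepancy function is $$\Delta(z)=\frac1N\sum_{n=1}^N \mathbf{1}_{[0,z)}(x_n)-\lambda([0,z)),$$ where $[0,z)=\prod_{i=1}^d[0,z_i)$ and $\lambda$ is $d$-dimensional Lebesgue measure. For a non-empty subset $\mathfrak{u}\subset\{1,\dots,d\}$, $(z(\mathfrak{u});1)$ denotes the point of $[0,1]^d$ obtained from $z$ by replacing every coordinate whose index is not in $\mathfrak{u}$ by $1$. The weighted star-discrepancy is $$D_{N,\gamma}^*(x_1,\dots,x_N)=\sup_{z\in[0,1]^d}\ \max_{\emptyset\ne\mathfrak{u}\subset\{1,\dots,d\}}\gamma_{\mathfrak{u}}\,|\Delta(z(\mathfrak{u});1)|.$$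 $n_\gamma^*(d,\varepsilon)$ denotes the smallest possible cardinality of a set of points from $[0,1]^d$ whose weighted star-discrepancy with respect to $\gamma$ is at most $\varepsilon$. The weighted star-discrepancy (for given weights $\gamma$) is called strongly tractable if there exist non-negative constants $C,\beta$ such that $n_\gamma^*(d,\varepsilon)\le C\varepsilon^{-\beta}$ for all $d\ge1$ and $\varepsilon\in(0,1)$; in that case the infimum of the $\beta$ for which this holds (with some $C$) is called the $\varepsilon$-exponent of strong tractability. *)

(* Defs.v *)
From mathcomp Require Import all_boot all_order all_algebra.
From mathcomp Require Import all_classical all_reals all_analysis.
From mathcomp Require Import measurable_realfun.

Set Implicit Arguments.
Unset Strict Implicit.
Unset Printing Implicit Defensive.

Import Order.TTheory GRing.Theory Num.Theory.
Import numFieldNormedType.Exports.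

Local Open Scope classical_set_scope.
Local Open Scope ring_scope.

(* d-dimensional Lebesgue measure of a Borel set, as the d-fold product of the
   one-dimensional one: integrate the measures of the sections. *)
Fixpoint lebesgue_measure_tuple (R : realType) (d : nat) :
    set (d.-tuple R) -> \bar R :=
  match d with
  | 0 => fun A => (\1_A [tuple])%:E
  | d'.+1 => fun A =>
      (\int[@lebesgue_measure R]_x
         lebesgue_measure_tuple [set t : d'.-tuple R | A [tuple of x :: t]])%E
  end.

Definition unit_cube (R : realType) (d : nat) : set (d.-tuple R) :=
  [set z | forall i, 0 <= tnth z i <= 1].

Definition anchored_box (R : realType) (d : nat) (z : d.-tuple R) :
    set (d.-tuple R) :=
  [set x | forall i, 0 <= tnth x i < tnth z i].

Lemma lebesgue_measure_tuple_anchored_box (R : realType) (d : nat)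
    (z : d.-tuple R) : unit_cube z ->
  lebesgue_measure_tuple (anchored_box z) = (\prod_(i < d) tnth z i)%:E.
Proof.
elim: d z => [z _|d IHd z].
  rewrite big_ord0 /= indicE mem_set// => -[]//.
case/tupleP: z => a z zcube.
have [a0 _] := andP (zcube ord0); rewrite tnth0 in a0.
have zcube' : unit_cube z.
  by move=> i; have := zcube (lift ord0 i); rewrite tnthS.
rewrite big_ord_recl tnth0; under eq_bigr do rewrite tnthS.
have section (x : R) :
    lebesgue_measure_tuple
      [set t : d.-tuple R | anchored_box [tuple of a :: z] [tuple of x :: t]]
    = ((\prod_(i < d) tnth z i) * \1_`[0, a[ x)%:E.
  rewrite indicE; have [xa|xa] := boolP (x \in `[0, a[%classic).
    rewrite mulr1 -IHd//; congr lebesgue_measure_tuple.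
    apply/seteqP; split=> t /= tz i.
      by have := tz (lift ord0 i); rewrite !tnthS.
    have [j ->|->] := unliftP ord0 i; first by rewrite !tnthS.
    by rewrite !tnth0; move: xa; rewrite inE /= in_itv.
  rewrite mulr0 (_ : [set t | _] = set0).
    elim: (d) => [|n IHn] /=; first by rewrite indicE in_set0.
    by rewrite integral0_eq.
  apply/seteqP; split=> t //= /(_ ord0); rewrite !tnth0 => xa'.
  by move/negP: xa; apply; rewrite inE /= in_itv.
transitivity (\int[@lebesgue_measure R]_x
    ((\prod_(i < d) tnth z i)%:E * (\1_`[0, a[ x)%:E))%E.
  by apply: eq_integral => x _; rewrite -EFinM -section.
rewrite ge0_integralZl//=; last 2 first.
- by apply/measurable_EFinP; exact: measurable_indic.
- by rewrite lee_fin prodr_ge0// => i _; have /andP[] := zcube' i.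
rewrite integral_indic// setIT [X in (_ * X)%E]lebesgue_measure_itv/= lte_fin.
case: ltgtP a0 => // [_|<-] _; last by rewrite mule0 mul0r.
by rewrite oppr0 adde0 -EFinM mulrC.
Qed.

Definition discrepancy (R : realType) (d N : nat) (x : 'I_N -> d.-tuple R)
    (z : d.-tuple R) : R :=
  N%:R^-1 * \sum_(n < N) \1_(anchored_box z) (x n)
  - fine (lebesgue_measure_tuple (anchored_box z)).

(* The point (z(u); 1). *)
Definition fill_ones (R : realType) (d : nat) (u : {set 'I_d})
    (z : d.-tuple R) : d.-tuple R :=
  [tuple if i \in u then tnth z i else 1 | i < d].

Definition weighted_star_discrepancy (R : realType) (d : nat)
    (w : {set 'I_d} -> R) (N : nat) (x : 'I_N -> d.-tuple R) : \bar R :=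
  ereal_sup [set \big[maxe/-oo%E]_(u : {set 'I_d} | u != finset.set0)
                   (w u * `|discrepancy x (fill_ones u z)|)%:E
            | z in @unit_cube R d].

(* Multisets of N points are families indexed by 'I_N; an infimum of a nonempty
   set of naturals is its least element (and +oo would mean that no N works). *)
Definition nstar (R : realType) (d : nat) (w : {set 'I_d} -> R) (eps : R) :
    \bar R :=
  ereal_inf [set N%:R%:E
            | N in [set N : nat | (0 < N)%N /\
                exists x : 'I_N -> d.-tuple R,
                  (forall n, unit_cube (x n)) /\
                  (weighted_star_discrepancy w x <= eps%:E)%E]].

Definition tractability_bound (R : realType)
    (w : forall d : nat, {set 'I_d} -> R) (C beta : R) : Prop :=
  forall (d : nat) (eps : R), (0 < d)%N -> 0 < eps < 1 ->
    (nstar (w d) eps <= (C * eps `^ (- beta))%:E)%E.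

Definition strongly_tractable (R : realType)
    (w : forall d : nat, {set 'I_d} -> R) : Prop :=
  exists C beta : R, [/\ 0 <= C, 0 <= beta & tractability_bound w C beta].

(* Only meaningful under strong tractability, when the set is nonempty. *)
Definition tractability_exponent (R : realType)
    (w : forall d : nat, {set 'I_d} -> R) : R :=
  inf [set beta | 0 <= beta /\ exists C : R, 0 <= C /\ tractability_bound w C beta].

(* Coordinates are numbered from 1, so i : 'I_d is coordinate i.+1; the value
   gamma 0 is not used. *)
Definition product_weights (R : realType) (gamma : nat -> R) (d : nat)
    (u : {set 'I_d}) : R :=
  \prod_(i in u) gamma i.+1.

(* Main.v *)
(** Threshold every coordinate of N points at 1/2. If 2 ^ N < d, two of the d
    coordinates, say i and j, have the same pattern, so the boxes that cut at
    1/2 in direction i only and in both directions i and j contain the same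
    points, although their volumes are 1/2 and 1/4: one of them has discrepancy
    at least 1/8. Hence if gamma >= g on the first d coordinates, with g <= 1,
    error g ^ 2 / 16 needs at least log d points. With g = c / (log d) ^ a for
    infinitely many d, an exponent beta of strong tractability satisfies
    log d = O((log d) ^ (2 a beta)), that is beta >= 1 / (2 a). *)
Require Import Defs.
From mathcomp Require Import all_boot all_order all_algebra.
From mathcomp Require Import all_classical all_reals all_analysis.
From mathcomp Require Import lra.

Import Order.TTheory GRing.Theory Num.Theory.
Import numFieldNormedType.Exports.

Local Open Scope classical_set_scope.
Local Open Scope ring_scope.

Lemma discrepancy_fill_ones_half (R : realType) (d N : nat)
    (x : 'I_N -> d.-tuple R) (u : {set 'I_d}) :
  discrepancy x (fill_ones u [tuple 2^-1 | _ < d]) =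
  N%:R^-1 * (\sum_(n < N)
    \1_(anchored_box (fill_ones u [tuple 2^-1 | _ < d])) (x n)) - 2^-1 ^+ #|u|.
Proof.
rewrite /discrepancy lebesgue_measure_tuple_anchored_box/=.
  congr (_ - _); rewrite -prodr_const [RHS]big_mkcond/=.
  by apply: eq_bigr => i _; rewrite !tnth_mktuple.
by move=> i; rewrite !tnth_mktuple; case: ifP => _; lra.
Qed.

Lemma ge_weighted_star_discrepancy (R : realType) (d : nat)
    (w : {set 'I_d} -> R) (N : nat) (x : 'I_N -> d.-tuple R) (z : d.-tuple R)
    (u : {set 'I_d}) :
  unit_cube z -> u != finset.set0 ->
  ((w u * `|discrepancy x (fill_ones u z)|)%:E
     <= weighted_star_discrepancy w x)%E.
Proof.
move=> zcube u0; apply: le_trans (ereal_sup_ubound _); last by exists z.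
by rewrite (bigD1 u)//= le_max lexx.
Qed.

Lemma weighted_star_discrepancy_ge (R : realType) (gamma : nat -> R)
    (d N : nat) (x : 'I_N -> d.-tuple R) (g : R) :
  0 <= g <= 1 -> (forall i, (i < d)%N -> g <= gamma i.+1) -> (2 ^ N < d)%N ->
  ((g ^+ 2 / 8)%:E <= weighted_star_discrepancy (@product_weights R gamma d) x)%E.
Proof.
move=> /andP[g0 g1] gle ltd.
pose bits (i : 'I_d) := [ffun n : 'I_N => tnth (x n) i < 2^-1].
have /injectivePn[i [j ij bitsij]] : ~~ injectiveb bits.
  apply/negP => /injectiveP/leq_card.
  by rewrite card_ffun card_bool !card_ord leqNgt ltd.
have eqbit n : (tnth (x n) i < 2^-1) = (tnth (x n) j < 2^-1).
  by have /ffunP/(_ n) := bitsij; rewrite !ffunE.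
pose h : d.-tuple R := [tuple 2^-1 | _ < d].
have hcube : unit_cube h by move=> k; rewrite tnth_mktuple; lra.
(* A box with side 1 excludes the points whose coordinate is 1; this is harmless
   here since the j-th coordinate of a point in the first box is below 1/2. *)
have same_points n : \1_(anchored_box (fill_ones [set i]%SET h)) (x n) =
    \1_(anchored_box (fill_ones [set i; j]%SET h)) (x n) :> R.
  rewrite !indicE; congr (nat_of_bool _)%:R.
  apply/idP/idP => /set_mem H; apply/mem_set => k; have := H k;
    rewrite !tnth_mktuple !inE.
    have [->//|ki/=] := eqVneq k i; have [->|//] := eqVneq k j.
    have := H i; rewrite !tnth_mktuple inE eqxx eqbit => /andP[_ ->].
    by move=> /andP[->].
  have [//|ki/=] := eqVneq k i; have [->|//] := eqVneq k j.
  by move=> /andP[-> /=] /lt_trans; apply; lra.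
(* Since [g <= 1], [g ^+ 2] is a common lower bound for the weights of the singleton and of the
   pair. *)
have wi : g ^+ 2 <= product_weights gamma [set i]%SET.
  rewrite /product_weights big_set1; apply: le_trans (gle _ (ltn_ord i)).
  by rewrite expr2 ler_piMl.
have wij : g ^+ 2 <= product_weights gamma [set i; j]%SET.
  rewrite /product_weights big_setU1 ?inE//= big_set1 expr2.
  by rewrite ler_pM// gle.
have ge1 := @ge_weighted_star_discrepancy _ _ (@product_weights R gamma d) _ x h
  [set i]%SET hcube.
have ge2 := @ge_weighted_star_discrepancy _ _ (@product_weights R gamma d) _ x h
  [set i; j]%SET hcube.
have {}ge1 := ge1 (introT (set0Pn _) (ex_intro _ i (set11 i))).
have {}ge2 := ge2 (introT (set0Pn _) (ex_intro _ i (set21 i j))).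
move: ge1 ge2.
rewrite !discrepancy_fill_ones_half cards1 cards2 ij.
rewrite (eq_bigr _ (fun n _ => same_points n)) -/h.
set p := _ * \sum_(n < N) _ => ge1 ge2.
(* The midpoint 3/8 of the two volumes 1/4 and 1/2: the common fraction [p] of points is at least
   1/8 away from one of them. *)
have [p38|p38] := leP p (3 / 8).
  apply: le_trans ge1; rewrite lee_fin ler_pM// ?exprn_ge0//.
  by rewrite ler0_norm; lra.
apply: le_trans ge2; rewrite lee_fin ler_pM// ?exprn_ge0//.
by rewrite ger0_norm; lra.
Qed.

Lemma nstar_ge (R : realType) (gamma : nat -> R) (d : nat) (g : R) :
  (0 < d)%N -> 0 < g <= 1 -> (forall i, (i < d)%N -> g <= gamma i.+1) ->
  ((ln d%:R)%:E <= nstar (@product_weights R gamma d) (g ^+ 2 / 16))%E.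
Proof.
move=> d0 /andP[g0 g1] gle; apply: le_ereal_inf_tmp => _ [N [N0 [x [_ xle]]] <-].
(* If [2 ^ N < d], the discrepancy is at least [g ^+ 2 / 8], which exceeds the allowed
   [g ^+ 2 / 16]. Otherwise [ln d <= N * ln 2 <= N]. *)
have [ltd|led] := ltnP (2 ^ N) d.
  have g01 : 0 <= g <= 1 by rewrite ltW.
  have := le_trans (weighted_star_discrepancy_ge _ _ _ _ x _ g01 gle ltd) xle.
  have : 0 < g ^+ 2 by rewrite exprn_gt0.
  by rewrite !lee_fin; clear xle; lra.
rewrite lee_fin (@le_trans _ _ (ln ((2 ^ N)%:R)))//.
  by rewrite ler_ln ?posrE ?ltr0n ?expn_gt0// ler_nat.
rewrite natrX lnXn ?ltr0n// -[leLHS]mulr_natl ler_piMr//.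
by rewrite -[2]/(1 + 1) le_ln1Dx//; lra.
Qed.

Lemma infinite_set_nat_unbounded (A : set nat) (n : nat) :
  infinite_set A -> exists2 j, A j & (n <= j)%N.
Proof.
move=> Ainf; apply: contrapT => Abnd; apply: Ainf.
apply: (sub_finite_set _ (finite_II n)) => j Aj /=.
by rewrite ltnNge; apply/negP => nj; apply: Abnd; exists j.
Qed.

Lemma ln_natr_ge (R : realType) (y : R) (n : nat) :
  (Num.Def.archi_bound (expR y) <= n)%N -> y <= ln n%:R.
Proof.
rewrite -(ler_nat R) => /(lt_le_trans (archi_boundP (expR_ge0 y))) yn.
by rewrite -[leLHS]expRK ler_ln ?posrE ?expR_gt0 ?(lt_trans _ yn) ?expR_gt0// ltW.
Qed.

Lemma tractability_bound_exponent_ge (R : realType) (gamma : nat -> R)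
    (c a C beta : R) :
  (forall i j : nat, (1 <= i)%N -> (i <= j)%N -> gamma j <= gamma i) ->
  0 < c -> 0 < a ->
  infinite_set [set j : nat | (1 <= j)%N /\ c / (ln j%:R) `^ a <= gamma j] ->
  tractability_bound (product_weights gamma) C beta ->
  (2 * a)^-1 <= beta.
Proof.
move=> gamma_noninc c0 a0 ginf bound; rewrite leNgt; apply/negP => ltbeta.
pose s := 1 - 2 * a * beta.
have s0 : 0 < s.
  by rewrite /s subr_gt0 -ltr_pdivlMl ?mulr_gt0// mulr1.
(* Capping [c] at 1 ensures [g <= 1] below. *)
pose c' := Num.min c 1.
have c'0 : 0 < c' by rewrite lt_min c0/=.
have c'1 : c' <= 1 by rewrite ge_min lexx orbT.
pose M := C * (c' ^+ 2 / 16) `^ (- beta).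
pose L0 := Num.max 1 ((`|M| + 1) `^ s^-1).
have [d [d0 cle] led] := infinite_set_nat_unbounded _
  (Num.Def.archi_bound (expR L0)) ginf.
have L0le : L0 <= ln d%:R.
  exact: ln_natr_ge.
set L := ln d%:R in cle L0le.
have L1 : 1 <= L by apply: le_trans L0le; rewrite le_max lexx.
have L_gt0 : 0 < L by apply: lt_le_trans L1.
have La1 : 1 <= L `^ a by rewrite -[leLHS](powRr0 L) ler_powR// ltW.
have La0 : 0 < L `^ a by apply: lt_le_trans La1.
pose g := c' / L `^ a.
have g0 : 0 < g by rewrite divr_gt0.
have g1 : g <= 1 by rewrite ler_pdivrMr// mul1r (le_trans c'1).
(* By monotonicity, the bound at the single index [d] passes to all earlier coordinates. *)
have gle i : (i < d)%N -> g <= gamma i.+1.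
  move=> id; apply: le_trans (gamma_noninc _ _ _ id) => //.
  by apply: le_trans cle; rewrite ler_pM2r ?invr_gt0// ge_min lexx.
have eps01 : 0 < g ^+ 2 / 16 < 1.
  have : 0 < g ^+ 2 by rewrite exprn_gt0.
  have : g ^+ 2 <= 1 by rewrite exprn_ile1// ltW.
  by lra.
have g01 : 0 < g <= 1 by rewrite g0.
have := le_trans (nstar_ge _ _ _ _ d0 g01 gle) (bound d _ d0 eps01).
rewrite lee_fin -/L.
have -> : g ^+ 2 / 16 = (c' ^+ 2 / 16) * L `^ (- (2 * a)).
  rewrite /g exprMn exprVn mulrAC; congr (_ * _).
  by rewrite powRN -powR_mulrn ?powR_ge0// -powRrM mulrC.
rewrite powRM ?powR_ge0 ?divr_ge0 ?exprn_ge0// ?(ltW c'0)// -powRrM mulrNN mulrA.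
have Lsplit : L = L `^ s * L `^ (2 * a * beta).
  rewrite -powRD; last by rewrite (gt_eqF L_gt0) implybT.
  by rewrite subrK powRr1// ltW.
rewrite -/M {1}Lsplit.
rewrite ler_pM2r ?powR_gt0//; apply/negP; rewrite -ltNge.
apply: (@lt_le_trans _ _ (`|M| + 1)); first by rewrite ltr_pwDr// ler_norm.
have -> : `|M| + 1 = ((`|M| + 1) `^ s^-1) `^ s.
  by rewrite -powRrM mulVf ?lt0r_neq0// powRr1// addr_ge0.
rewrite ge0_ler_powR ?nnegrE ?powR_ge0 ?(ltW s0) ?(ltW L_gt0)//.
by apply: le_trans L0le; rewrite le_max lexx orbT.
Qed.

Theorem theorem4 (R : realType) (gamma : nat -> R)
    (gamma_ge0 : forall j : nat, (1 <= j)%N -> 0 <= gamma j)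
    (gamma_noninc : forall i j : nat, (1 <= i)%N -> (i <= j)%N ->
       gamma j <= gamma i) :
  ((forall c eta : R, 0 < c -> 0 < eta ->
      infinite_set [set j : nat | (1 <= j)%N /\
                                  c / (ln j%:R) `^ eta <= gamma j]) ->
   ~ strongly_tractable (product_weights gamma))
  /\
  ((exists c eta : R, [/\ 0 < c, 0 < eta &
      infinite_set [set j : nat | (1 <= j)%N /\
                                  c / (ln j%:R) `^ (1 / 4 - eta) <= gamma j]]) ->
   strongly_tractable (product_weights gamma) ->
   2 < tractability_exponent (product_weights gamma)).
Proof.
split=> [ginf [C [beta [C0 beta0 bound]]]|].
  (* Chosen so that [(2 * a)^-1 = beta + 1], which exceeds [beta]. *)
  pose a := (2 * (beta + 1))^-1.
  have a0 : 0 < a by rewrite invr_gt0; lra.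
  have := tractability_bound_exponent_ge _ _ _ _ _ _ gamma_noninc ltr01 a0
    (ginf _ _ ltr01 a0) bound.
  by rewrite /a invfM invrK mulrA mulVf// mul1r; lra.
move=> [c [eta [c0 eta0 ginf]]] [C [beta [C0 beta0 bound]]].
(* The maximum keeps [a] positive when [eta >= 1 / 4], and still below 1/4. *)
pose a := Num.max (1 / 4 - eta) (1 / 8).
have a0 : 0 < a by rewrite lt_max; apply/orP; right; lra.
have a4 : a < 1 / 4 by rewrite gt_max; lra.
have ginf' : infinite_set
    [set j : nat | (1 <= j)%N /\ c / (ln j%:R) `^ a <= gamma j].
  (* Raising the exponent to [a] weakens the condition only where [ln j >= 1]; the finitely many
     [j < n] are set aside. *)
  pose n := Num.Def.archi_bound (expR 1 : R).
  move=> fin; apply: ginf.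
  have := conj (finite_II n) fin; rewrite -finite_setU.
  apply: sub_finite_set => j [j1 cle] /=.
  have [|nj] := ltnP j n; [by left|right; split=> //].
  have lnj : 1 <= ln (j%:R : R) by exact: ln_natr_ge.
  apply: le_trans cle; rewrite ler_pM2l// lef_pV2 ?posrE ?powR_gt0//;
    try exact: lt_le_trans lnj.
  by rewrite ler_powR// le_max lexx.
(* A uniform lower bound above 2 is needed, as an infimum does not preserve strict inequalities.
   Strong tractability makes the set of exponents nonempty. *)
apply: (@lt_le_trans _ _ (2 * a)^-1); last first.
  apply: lb_le_inf; first by exists beta; split=> //; exists C.
  move=> b [_ [C' [_ boundC']]].
  exact: (tractability_bound_exponent_ge _ _ _ _ _ _ gamma_noninc c0 a0 ginf'
    boundC').
rewrite -[ltLHS]invrK ltf_pV2 ?posrE; lra.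
Qed.
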